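(* Let $n\ge0$ and let $H_n$ be the pyrene system with $n$ pyrene fragments. Then $$F(H_n,x)=x^{n}\sum_{j=0}^{n}\sum_{i=\lceil\frac{j+n}{2}\rceil}^{n}(-1)^{n-i}2^{2i+j-n}\binom{i}{n-i}\binom{2i-n}{j}x^{j}.$$
   Context: Pyrene system: draw the hexagonal lattice so that every hexagon has two vertical sides; horizontally adjacent hexagons then share a vertical edge. For $n\ge1$, $H_n$ is the hexagonal system (the plane graph formed by the vertices and edges of the following $4n$ hexagons) consisting of a horizontal linear row of $2n$ hexagons $h_{1,1},h_{1,2},\dots,h_{n,1},h_{n,2}$, consecutive ones sharing a vertical edge, together with, for each $i$, a hexagon $s_{i,1}$ directly above and a hexagon $s_{i,2}$ directly below the common edge of $h_{i,1}$ and $h_{i,2}$ (each sharing an edge with both $h_{i,1}$ and $h_{i,2}$). $H_0$ is the null graph (with forcing polynomial $1$). For a perfect matching $M$ of $G$, a forcing set is a subset $S\subseteq M$ contained in no other perfect matching of $G$, and the forcing number $f(G,M)$ is the minimum size of a forcing set. The forcing polynomial is $F(G,x)=\sum_{M\in\mathcal{M}(G)}x^{f(G,M)}$, where $\mathcal{M}(G)$ is the set of perfect matchings of $G$. *)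

(* Defs.v *)
From mathcomp Require Import all_boot all_order all_algebra.
Set Implicit Arguments. Unset Strict Implicit. Unset Printing Implicit Defensive.
Import GRing.Theory.
Local Open Scope ring_scope.

(* ---------- Generic notions for a finite graph (VS, ES) ----------
   Vertices live in a finType V; the graph has vertex set VS : {set V}
   and edge set ES : {set {set V}} (each edge a 2-element set).        *)
Section Matchings.
Variable V : finType.
Variables (VS : {set V}) (ES : {set {set V}}).

Definition perfect_matching (M : {set {set V}}) : bool :=
  (M \subset ES) && [forall v in VS, #|[set e in M | v \in e]| == 1%N].

Definition forcing_set (M S : {set {set V}}) : bool :=
  (S \subset M) &&
  [forall M' : {set {set V}}, (perfect_matching M' && (S \subset M')) ==> (M' == M)].

(* forcing number f(G,M): minimum size of a forcing set
   (M itself is a forcing set when M is perfect, so #|M| is a safe default) *)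
Definition forcing_number (M : {set {set V}}) : nat :=
  \big[minn/#|M|]_(S : {set {set V}} | forcing_set M S) #|S|.

Definition forcing_poly : {poly int} :=
  \sum_(M : {set {set V}} | perfect_matching M) 'X^(forcing_number M).
End Matchings.

(* ---------- The pyrene system H_n ----------
   Hexagonal lattice drawn as a brick wall: a hexagon with two vertical sides
   is the brick with lower-left corner (x,y): vertices (x..x+2, y), (x..x+2, y+1),
   edges the two horizontal paths and the two vertical sides at x and x+2.
   Horizontally adjacent bricks share a vertical side, and the brick at
   (x+1, y+1) (resp. (x+1, y-1)) sits directly above (resp. below) the common
   vertical edge of the bricks at (x,y) and (x+2,y).                    *)
Definition pV (n : nat) := ('I_(4 * n).+1 * 'I_4)%type.
Definition pt (n x y : nat) : pV n := (inord x, inord y).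

Definition hex_vertices (n x y : nat) : {set pV n} :=
  [set pt n x y; pt n x.+1 y; pt n x.+2 y;
       pt n x y.+1; pt n x.+1 y.+1; pt n x.+2 y.+1].

Definition hex_edges (n x y : nat) : {set {set pV n}} :=
  [set [set pt n x y; pt n x.+1 y]; [set pt n x.+1 y; pt n x.+2 y];
       [set pt n x y.+1; pt n x.+1 y.+1]; [set pt n x.+1 y.+1; pt n x.+2 y.+1];
       [set pt n x y; pt n x y.+1]; [set pt n x.+2 y; pt n x.+2 y.+1]].

(* For fragment i < n: h_{i,1} at (4i,1), h_{i,2} at (4i+2,1),
   s_{i,1} at (4i+1,2) (above), s_{i,2} at (4i+1,0) (below). *)
Definition pyrene_hexes (n : nat) : seq (nat * nat) :=
  flatten [seq [:: (4 * i, 1); (4 * i + 2, 1); (4 * i + 1, 2); (4 * i + 1, 0)]%N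
          | i <- iota 0 n].

Definition pyrene_VS (n : nat) : {set pV n} :=
  \bigcup_(h <- pyrene_hexes n) hex_vertices n h.1 h.2.
Definition pyrene_ES (n : nat) : {set {set pV n}} :=
  \bigcup_(h <- pyrene_hexes n) hex_edges n h.1 h.2.

Definition pyrene_forcing_poly (n : nat) : {poly int} :=
  forcing_poly (pyrene_VS n) (pyrene_ES n).

(* Main.v *)
Require Import Defs.
From mathcomp Require Import all_boot all_order all_algebra.
From mathcomp Require Import zify ring.
Import GRing.Theory.
Local Open Scope nat_scope.

(* Cut a perfect matching into its fragments. Matching the top (bottom) hexagon of a
   fragment takes away one of the two odd vertices of the row below (above) it, and this
   leaves six states per fragment: if the middle edge of the fragment is unused, the top
   and bottom can be chosen independently (four states); if it is used, the whole fragment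
   leans either left or right (two states). The only obstruction to an arbitrary sequence
   of states is that a left state may not be followed by a right state, as both would
   match the end vertices of the edge shared by the two fragments.

   In a fragment with unused middle edge the top and the bottom hexagon are alternating; in
   the other two states one of the hexagons beside the middle edge is. These hexagons have
   no matching edge in common, and one well-chosen edge in each of them determines the
   states, so the forcing number is [n] plus the number of fragments with unused middle
   edge. Summing over the admissible sequences gives
   F(n+2) = (4 x^2 + 2 x) F(n+1) - x^2 F(n), which makes F(n) / x^n a Chebyshev polynomial
   of the second kind in 2 + 4 x. *)

Lemma in_bigcup_seq (I : eqType) (T : finType) (s : seq I) (F : I -> {set T}) x :
  (x \in \bigcup_(i <- s) F i) = has (fun i => x \in F i) s.
Proof. by elim: s => [|i s IHs]; rewrite ?big_nil ?big_cons inE //= IHs. Qed.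

Section ForcingNumber.
Variables (V : finType) (VS : {set V}) (ES : {set {set V}}).

(* A forcing set contains, for each [j], an edge of [M] that [alt j] lacks, and
   these edges are distinct. *)
Lemma forcing_number_card (J : finType) (P : {set J}) (M : {set {set V}})
    (g : J -> {set V}) (alt : J -> {set {set V}}) :
  forcing_set VS ES M (g @: P) ->
  (forall j, j \in P -> perfect_matching VS ES (alt j)) ->
  (forall j, j \in P -> alt j != M) ->
  (forall e j k, j \in P -> k \in P -> e \in M ->
     e \notin alt j -> e \notin alt k -> j = k) ->
  forcing_number VS ES M = #|P|.
Proof.
move=> gF altPM altM altI.
have lower S : forcing_set VS ES M S -> #|P| <= #|S|.
  case/andP=> SM /forallP SF.
  pose h j := odflt set0 [pick e in S | e \notin alt j].
  have hP j : j \in P -> h j \in S /\ h j \notin alt j.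
    move=> jP; rewrite /h; case: pickP => [e /andP[]|S0] //=.
    have /implyP := SF (alt j); rewrite altPM //=.
    have -> : S \subset alt j.
      by apply/subsetP => e eS; have := S0 e; rewrite eS => /negbFE.
    by move=> /(_ isT); rewrite (negPf (altM j jP)).
  have hI : {in P &, injective h}.
    move=> j k jP kP hjk; have [hjS hj] := hP j jP; have [_ hk] := hP k kP.
    by apply: (altI (h j)); rewrite ?(subsetP SM) // hjk.
  rewrite -(card_in_imset hI); apply/subset_leq_card/subsetP => _ /imsetP[j jP ->].
  by case: (hP j jP).
apply/eqP; rewrite eqn_leq; apply/andP; split.
  apply: leq_trans (leq_imset_card g P); rewrite /forcing_number.
  elim: (index_enum _) (mem_index_enum (g @: P)) => // S s IHs.
  rewrite inE big_cons => /predU1P[<-|/IHs le_s]; first by rewrite gF geq_minl.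
  by case: ifP => // _; apply: leq_trans (geq_minr _ _) le_s.
rewrite /forcing_number; elim/big_ind: _ => [|a b ha hb|S /lower //].
  by apply: leq_trans (lower _ gF) (subset_leq_card _); case/andP: gF.
by rewrite leq_min ha.
Qed.

End ForcingNumber.

(* [edge n x y true] is horizontal and [edge n x y false] is vertical; [(x, y)] is
   the left or lower end. *)
Definition edge (n x y : nat) (d : bool) : {set pV n} :=
  [set pt n x y; if d then pt n x.+1 y else pt n x y.+1].

Definition is_edge (n x y : nat) (d : bool) : bool :=
  match y, d with
  | 0, true | 3, true => (x < 4 * n) && ((x %% 4 == 1) || (x %% 4 == 2))
  | 1, true | 2, true => x < 4 * n
  | 0, false | 2, false => (x < 4 * n) && ((x %% 4 == 1) || (x %% 4 == 3))
  | 1, false => [&& 0 < n, x <= 4 * n & x %% 2 == 0]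
  | _, _ => false
  end.

Definition is_vertex (n x y : nat) : bool :=
  [&& 0 < n, x <= 4 * n, y < 4 & (0 < y < 3) || (x %% 4 != 0)].

Lemma is_edge_range n x y d : is_edge n x y d ->
  x + d <= 4 * n /\ y + ~~ d <= 3.
Proof. by case: d; case: y => [|[|[|[|y]]]] //=; lia. Qed.

Lemma pt_eq n x y x' y' : x <= 4 * n -> x' <= 4 * n -> y <= 3 -> y' <= 3 ->
  (pt n x y == pt n x' y') = (x == x') && (y == y').
Proof. by move=> hx hx' hy hy'; rewrite xpair_eqE -!val_eqE /= !inordK. Qed.

Lemma mem_edge n x y x' y' d : is_edge n x' y' d -> x <= 4 * n -> y <= 3 ->
  (pt n x y \in edge n x' y' d) =
  (x == x') && (y == y') || (x == x' + d) && (y == y' + ~~ d).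
Proof.
move=> /is_edge_range[hx' hy'] hx hy; rewrite !inE.
rewrite pt_eq //; try lia.
by case: d hx' hy' => /= hx' hy'; rewrite pt_eq ?addn1 ?addn0 //; lia.
Qed.

Lemma edge_inj n x y d x' y' d' : is_edge n x y d -> is_edge n x' y' d' ->
  edge n x y d = edge n x' y' d' -> [/\ x = x', y = y' & d = d'].
Proof.
move=> he he' E.
have [hx hy] := is_edge_range _ _ _ _ he; have [hx' hy'] := is_edge_range _ _ _ _ he'.
have h1 : pt n x y \in edge n x' y' d' by rewrite -E !inE eqxx.
have h2 : pt n (x + d) (y + ~~ d) \in edge n x' y' d'.
  by rewrite -E mem_edge ?eqxx ?orbT.
have h3 : pt n x' y' \in edge n x y d by rewrite E !inE eqxx.
move: h1 h2 h3; rewrite !mem_edge //; try lia.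
by case: d d' {E he he'} hx hy hx' hy' => [] [] /=; split; lia.
Qed.

Definition on_hex (X Y x y : nat) (d : bool) : bool :=
  if d then ((x == X) || (x == X.+1)) && ((y == Y) || (y == Y.+1))
  else ((x == X) || (x == X.+2)) && (y == Y).

Lemma hex_edgesP n X Y e :
  reflect (exists x y d, on_hex X Y x y d /\ e = edge n x y d) (e \in hex_edges n X Y).
Proof.
rewrite /hex_edges !inE -!orbA; apply: (iffP idP).
  case/or3P=> [/eqP->|/eqP->|/or4P[]/eqP->];
    [exists X, Y, true | exists X.+1, Y, true | exists X, Y.+1, true
    | exists X.+1, Y.+1, true | exists X, Y, false | exists X.+2, Y, false];
  by rewrite /= !eqxx ?orbT.
case=> x [y [[] [/= /andP[/orP[]/eqP-> h] ->]]].
- by case/orP: h => /eqP->; rewrite eqxx ?orbT.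
- by case/orP: h => /eqP->; rewrite eqxx ?orbT.
- by rewrite (eqP h) eqxx ?orbT.
- by rewrite (eqP h) eqxx ?orbT.
Qed.

Definition fragment (i : nat) : seq (nat * nat) :=
  [:: (4 * i, 1); (4 * i + 2, 1); (4 * i + 1, 2); (4 * i + 1, 0)].

Lemma mem_fragment i X Y : ((X, Y) \in fragment i) =
  [|| (X == 4 * i) && (Y == 1), (X == 4 * i + 2) && (Y == 1),
      (X == 4 * i + 1) && (Y == 2) | (X == 4 * i + 1) && (Y == 0)].
Proof. by rewrite !inE !xpair_eqE. Qed.

Lemma mem_pyrene_hexes n h :
  reflect (exists2 i, i < n & h \in fragment i) (h \in pyrene_hexes n).
Proof.
apply: (iffP flatten_mapP) => [] [i]; first by rewrite mem_iota => /andP[_]; exists i.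
by move=> *; exists i => //; rewrite mem_iota.
Qed.

Lemma pyrene_ESP n e :
  reflect (exists x y d, is_edge n x y d /\ e = edge n x y d) (e \in pyrene_ES n).
Proof.
rewrite /pyrene_ES in_bigcup_seq; apply: (iffP hasP).
  case=> -[X Y] /mem_pyrene_hexes[i hi]; rewrite mem_fragment => hXY.
  case/hex_edgesP => x [y [d [hd ->]]]; exists x, y, d; split=> //.
  by case: d hd; rewrite /= /is_edge; case: y => [|[|[|[|y]]]]; lia.
case=> x [y [d [he ->]]].
pose i := minn (x %/ 4) n.-1.
have W X Y : i < n -> (X, Y) \in fragment i -> on_hex X Y x y d ->
    exists2 h, h \in pyrene_hexes n & edge n x y d \in hex_edges n h.1 h.2.
  move=> hi hh hd; exists (X, Y); first by apply/mem_pyrene_hexes; exists i.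
  by apply/hex_edgesP; exists x, y, d.
have hi : i < n by case: d y he {W} => [] [|[|[|[|y]]]] //=; rewrite /i; lia.
case: d y he W => [] [|[|[|[|y]]]] //= he W.
- by apply: (W (4 * i + 1) 0); rewrite ?mem_fragment //= /i; lia.
- case: (ltnP (x %% 4) 2) => hr.
    by apply: (W (4 * i) 1); rewrite ?mem_fragment //= /i; lia.
  by apply: (W (4 * i + 2) 1); rewrite ?mem_fragment //= /i; lia.
- case: (ltnP (x %% 4) 2) => hr.
    by apply: (W (4 * i) 1); rewrite ?mem_fragment //= /i; lia.
  by apply: (W (4 * i + 2) 1); rewrite ?mem_fragment //= /i; lia.
- by apply: (W (4 * i + 1) 2); rewrite ?mem_fragment //= /i; lia.
- by apply: (W (4 * i + 1) 0); rewrite ?mem_fragment //= /i; lia.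
- case: (ltnP (x - 4 * i) 2) => hr.
    by apply: (W (4 * i) 1); rewrite ?mem_fragment //= /i; lia.
  by apply: (W (4 * i + 2) 1); rewrite ?mem_fragment //= /i; lia.
- by apply: (W (4 * i + 1) 2); rewrite ?mem_fragment //= /i; lia.
Qed.

Lemma hex_verticesP n X Y v :
  reflect (exists x y, [/\ X <= x <= X.+2, Y <= y <= Y.+1 & v = pt n x y])
          (v \in hex_vertices n X Y).
Proof.
rewrite /hex_vertices !inE -!orbA; apply: (iffP idP).
  case/or3P=> [/eqP->|/eqP->|/or4P[]/eqP->];
    [exists X, Y | exists X.+1, Y | exists X.+2, Y
    | exists X, Y.+1 | exists X.+1, Y.+1 | exists X.+2, Y.+1]; split=> //; lia.
case=> x [y [hx hy ->]].
have hx' : [|| x == X, x == X.+1 | x == X.+2] by lia.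
have hy' : (y == Y) || (y == Y.+1) by lia.
by case/or3P: hx' => /eqP->; case/orP: hy' => /eqP->; rewrite eqxx ?orbT.
Qed.

Lemma pyrene_VSP n v :
  reflect (exists x y, is_vertex n x y /\ v = pt n x y) (v \in pyrene_VS n).
Proof.
rewrite /pyrene_VS in_bigcup_seq; apply: (iffP hasP).
  case=> -[X Y] /mem_pyrene_hexes[i hi]; rewrite mem_fragment => hXY.
  case/hex_verticesP => x [y [/= hx hy ->]]; exists x, y; split=> //.
  by rewrite /is_vertex; lia.
case=> x [y [hv ->]].
pose i := minn (x %/ 4) n.-1.
pose X := if (0 < y < 3) then 4 * i + (if x - 4 * i <= 2 then 0 else 2) else 4 * i + 1.
pose Y := if y is 3 then 2 else if y is 0 then 0 else 1.
exists (X, Y).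
  apply/mem_pyrene_hexes; exists i; first by move: hv; rewrite /is_vertex /i; lia.
  rewrite mem_fragment /X /Y.
  by case: y hv {X Y} => [|[|[|[|y]]]] //=; rewrite /is_vertex /i => hv; try case: ifP; lia.
apply/hex_verticesP; exists x, y; split=> //; move: hv; rewrite /is_vertex /=.
  by rewrite /X /i {X Y}; case: y => [|[|[|[|y]]]] //= hv; try case: ifP; lia.
by rewrite /Y {X Y}; case: y => [|[|[|[|y]]]] //=; lia.
Qed.

(* Whether a set of edges contains the edge at the given coordinates; [false] on
   coordinates of no edge, where [edge] may collide with an actual one. *)
Definition uses n (M : {set {set pV n}}) x y d := is_edge n x y d && (edge n x y d \in M).

Definition degree (m : nat -> nat -> bool -> bool) x y : nat :=
  ((0 < x) && m x.-1 y true) + m x y true + ((0 < y) && m x y.-1 false) + m x y false.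

Lemma card_incident n (M : {set {set pV n}}) x y :
  M \subset pyrene_ES n -> x <= 4 * n -> y <= 3 ->
  #|[set e in M | pt n x y \in e]| = degree (uses n M) x y.
Proof.
move=> /subsetP ME hx hy.
pose ed (k : nat * nat * bool) := edge n k.1.1 k.1.2 k.2.
pose K := (if 0 < x then [:: (x.-1, y, true)] else [::]) ++ [:: (x, y, true)] ++
  (if 0 < y then [:: (x, y.-1, false)] else [::]) ++ [:: (x, y, false)].
have memK x' y' d : ((x', y', d) \in K) =
    if d then (y' == y) && ((x' == x) || (0 < x) && (x' == x.-1))
    else (x' == x) && ((y' == y) || (0 < y) && (y' == y.-1)).
  by rewrite /K; case: (0 < x); case: (0 < y); case: d;
     rewrite !inE !xpair_eqE /= ?andbT ?andbF; lia.
pose K' := [seq k <- K | uses n M k.1.1 k.1.2 k.2].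
have -> : [set e in M | pt n x y \in e] = [set e in map ed K'].
  apply/setP => e; rewrite !inE; apply/andP/mapP.
    case=> eM; have /pyrene_ESP[x' [y' [d [he E]]]] := ME _ eM; move: eM; rewrite E => eM.
    rewrite mem_edge // => hxy; exists (x', y', d) => //.
    rewrite mem_filter /uses /= he eM memK /=.
    by case: d he {E eM} hxy => /= _ hxy; lia.
  case=> -[[x' y'] d]; rewrite mem_filter /uses /ed /= => /andP[/andP[he eM] hK] ->.
  split=> //; rewrite mem_edge //; move: hK; rewrite memK.
  by case: d {he eM} => /=; lia.
rewrite cardsE (card_uniqP _); last first.
  rewrite map_inj_in_uniq; last first.
    move=> [[x1 y1] d1] [[x2 y2] d2]; rewrite !mem_filter /uses /= => /andP[/andP[h1 _] _].
    by move=> /andP[/andP[h2 _] _] /(edge_inj _ _ _ _ _ _ _ h1 h2)[-> -> ->].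
  apply: filter_uniq; rewrite /K; case: ifP => hx0; case: ifP => hy0 /=;
    rewrite !inE !xpair_eqE /= ?eqxx ?andbT ?andbF ?orbF //; lia.
rewrite size_map size_filter /K /degree !count_cat.
by case: (0 < x); case: (0 < y); rewrite /= ?addn0 ?add0n ?addnA.
Qed.

Lemma perfect_matchingP n (M : {set {set pV n}}) :
  reflect (M \subset pyrene_ES n /\
           forall x y, is_vertex n x y -> degree (uses n M) x y = 1)
          (perfect_matching (pyrene_VS n) (pyrene_ES n) M).
Proof.
apply: (iffP andP) => -[ME hM]; split=> //.
  move=> x y hv; have /and4P[_ hx hy _] := hv.
  rewrite -card_incident //; apply/eqP; move/forall_inP: hM; apply.
  by apply/pyrene_VSP; exists x, y.
apply/forall_inP => v /pyrene_VSP[x [y [hv ->]]]; have /and4P[_ hx hy _] := hv.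
by rewrite card_incident // hM.
Qed.

(* The state of one fragment in a perfect matching: [inl a] if the middle edge of the
   fragment is used, [inr (a, b)] otherwise. The boolean [a] tells whether the vertex
   [(4 i + 1, 2)] is matched upwards, [b] whether [(4 i + 1, 1)] is matched downwards;
   in the first case both agree. *)
Definition letter : finType := (bool + bool * bool)%type.

Definition center (l : letter) : bool := if l is inl _ then true else false.
Definition upper (l : letter) : bool := match l with inl a => a | inr p => p.1 end.
Definition lower (l : letter) : bool := match l with inl a => a | inr p => p.2 end.
Definition left_letter (l : letter) : bool := center l && upper l.
Definition right_letter (l : letter) : bool := center l && ~~ upper l.

Definition free_letter : letter := inr (true, true).

Lemma center_lower l : center l ==> (lower l == upper l).
Proof. by case: l => //= a; rewrite eqxx. Qed.

Definition compatible (l l' : letter) : bool := ~~ (left_letter l && right_letter l').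

Lemma sorted_compatibleP (w : seq letter) :
  reflect (forall i, compatible (nth free_letter w i) (nth free_letter w i.+1))
          (sorted compatible w).
Proof.
apply: (iffP (sortedP free_letter)) => // hw i.
case: (ltnP i.+1 (size w)) => [/hw //|hi]; rewrite /compatible.
by rewrite (nth_default _ hi) andbF.
Qed.

Definition row_edge (c a : bool) (r : nat) : bool :=
  match r with
  | 0 => c && ~~ a | 1 => ~~ c && ~~ a | 2 => ~~ c && a | _ => c && a
  end.

Definition word_edge (w : seq letter) (x y : nat) (d : bool) : bool :=
  let i := x %/ 4 in let r := x %% 4 in let l := nth free_letter w i in
  match y, d with
  | 0, true => (r == 1) != lower l
  | 1, true => row_edge (center l) (lower l) r
  | 2, true => row_edge (center l) (upper l) r
  | 3, true => (r == 1) != upper l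
  | 0, false => (r == 1) == lower l
  | 1, false => if r == 2 then center l
                else ~~ ((0 < i) && left_letter (nth free_letter w i.-1) || right_letter l)
  | 2, false => (r == 1) == upper l
  | _, _ => false
  end.

Definition word_uses n w x y d := is_edge n x y d && word_edge w x y d.

Definition word_matching n (w : seq letter) : {set {set pV n}} :=
  [set edge n k.1.1 k.1.2 k.2 | k : 'I_(4 * n).+1 * 'I_4 * bool
                              & word_uses n w k.1.1 k.1.2 k.2].

Lemma uses_word_matching n w x y d : uses n (word_matching n w) x y d = word_uses n w x y d.
Proof.
rewrite /uses /word_uses; case he: (is_edge n x y d) => //=.
apply/imsetP/idP => [[[[x' y'] d']]|hw].
  rewrite inE /= /word_uses => /andP[he' hw] E.
  by have [-> -> ->] := edge_inj _ _ _ _ _ _ _ he he' E.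
have [hx hy] := is_edge_range _ _ _ _ he.
have hx' : x < (4 * n).+1 by lia.
have hy' : y < 4 by lia.
by exists (Ordinal hx', Ordinal hy', d) => //; rewrite inE /= /word_uses he.
Qed.

Lemma word_matching_sub n w : word_matching n w \subset pyrene_ES n.
Proof.
apply/subsetP => e /imsetP[[[x y] d]]; rewrite inE /= => /andP[he _] ->.
by apply/pyrene_ESP; exists x, y, d.
Qed.

Lemma eq_degree m m' x y : (forall x y d, m x y d = m' x y d) -> degree m x y = degree m' x y.
Proof. by move=> E; rewrite /degree !E. Qed.

Lemma mod4_cases x : exists i, [\/ x = 4 * i, x = (4 * i).+1, x = (4 * i).+2 | x = (4 * i).+3].
Proof.
exists (x %/ 4).
have [E|[E|[E|E]]] : x = 4 * (x %/ 4) \/ x = (4 * (x %/ 4)).+1 \/ x = (4 * (x %/ 4)).+2 \/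
  x = (4 * (x %/ 4)).+3 by lia.
- by constructor 1.
- by constructor 2.
- by constructor 3.
- by constructor 4.
Qed.

Lemma coord4 i : ((4 * i) %/ 4 = i) * ((4 * i).+1 %/ 4 = i) * ((4 * i).+2 %/ 4 = i) *
  ((4 * i).+3 %/ 4 = i) * ((4 * i) %% 4 = 0) * ((4 * i).+1 %% 4 = 1) *
  ((4 * i).+2 %% 4 = 2) * ((4 * i).+3 %% 4 = 3) * ((4 * i) %% 2 = 0) *
  ((4 * i).+1 %% 2 = 1) * ((4 * i).+2 %% 2 = 0) * ((4 * i).+3 %% 2 = 1).
Proof. by do !split; lia. Qed.

Lemma bound4 n i :
  ((4 * i <= 4 * n) = (i <= n)) * (((4 * i).+1 <= 4 * n) = (i < n)) *
  (((4 * i).+2 <= 4 * n) = (i < n)) * (((4 * i).+3 <= 4 * n) = (i < n)) *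
  (((4 * i).+4 <= 4 * n) = (i < n)).
Proof. by do !split; lia. Qed.

Ltac case_letters :=
  repeat match goal with
  | |- context [center ?l] => case: (center l) => //=
  | |- context [upper ?l] => case: (upper l) => //=
  | |- context [lower ?l] => case: (lower l) => //=
  end.

Lemma degree_word_matching n (w : n.-tuple letter) x y :
  sorted compatible w -> is_vertex n x y -> degree (uses n (word_matching n w)) x y = 1.
Proof.
move=> /sorted_compatibleP hw hv; rewrite (eq_degree _ _ _ _ (uses_word_matching n w)).
have [i hx] := mod4_cases x.
have hlast : (i < n) || ~~ center (nth free_letter w i).
  by case: ltnP => // hi; rewrite nth_default ?size_tuple.
have hl := center_lower (nth free_letter w i).
case: hx hv => ->; case: y => [|[|[|[|y]]]]; rewrite /is_vertex ?coord4 ?bound4 ?andbF //=.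
- case/and3P=> n0 hi _; move: hl hlast hi; rewrite /degree /word_uses /word_edge.
  case: i => [|i].
    by rewrite /= !coord4 ?bound4 n0 /= /right_letter; case_letters.
  have -> : (4 * i.+1).-1 = (4 * i).+3 by lia.
  move: (hw i) (center_lower (nth free_letter w i)).
  rewrite /= !coord4 ?bound4 /= n0 /compatible /left_letter /right_letter.
  move=> hc hl' hl hlast hi; rewrite hi.
  by move: hc hl' hl hlast; rewrite /=; case: (i.+1 < n); case_letters.
- case/and3P=> n0 hi _; move: hl hlast hi; rewrite /degree /word_uses /word_edge.
  case: i => [|i].
    by rewrite /= !coord4 ?bound4 n0 /= /right_letter; case_letters.
  have -> : (4 * i.+1).-1 = (4 * i).+3 by lia.
  move: (hw i) (center_lower (nth free_letter w i)).
  rewrite /= !coord4 ?bound4 /= n0 /compatible /left_letter /right_letter.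
  move=> hc hl' hl hlast hi; rewrite hi.
  by move: hc hl' hl hlast; rewrite /=; case: (i.+1 < n); case_letters.
all: case/and3P=> n0 hi _; rewrite /degree /word_uses /word_edge /= !coord4 ?bound4 /=.
all: by move: hl; rewrite hi ?n0 /=; case_letters.
Qed.

Lemma word_matching_perfect n (w : n.-tuple letter) :
  sorted compatible w -> perfect_matching (pyrene_VS n) (pyrene_ES n) (word_matching n w).
Proof.
move=> hw; apply/perfect_matchingP; split; first exact: word_matching_sub.
by move=> x y; apply: degree_word_matching.
Qed.

Definition letter_of (m : nat -> nat -> bool -> bool) (i : nat) : letter :=
  let a := m (4 * i).+1 2 false in
  if m (4 * i).+2 1 false then inl a else inr (a, m (4 * i).+1 0 false).

Section Decode.
Variables (n : nat) (m : nat -> nat -> bool -> bool).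
Hypothesis m_edge : forall x y d, m x y d -> is_edge n x y d.
Hypothesis m_degree : forall x y, is_vertex n x y -> degree m x y = 1.

Let c i := m (4 * i).+2 1 false.
Let a i := m (4 * i).+1 2 false.
Let b i := m (4 * i).+1 0 false.

Lemma not_edge x y d : is_edge n x y d = false -> m x y d = false.
Proof. by move=> he; apply/negP => /m_edge; rewrite he. Qed.

Lemma upper_half i : i < n ->
  (m (4 * i) 2 true = c i && ~~ a i) * (m (4 * i).+1 2 true = ~~ c i && ~~ a i) *
  (m (4 * i).+2 2 true = ~~ c i && a i) * (m (4 * i).+3 2 true = c i && a i) *
  (m (4 * i).+1 3 true = ~~ a i) * (m (4 * i).+2 3 true = a i) *
  (m (4 * i).+3 2 false = ~~ a i).
Proof.
move=> hi; have n0 : 0 < n by lia.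
have D x y := m_degree x y.
move: (D (4 * i).+1 3) (D (4 * i).+2 3) (D (4 * i).+3 3)
      (D (4 * i).+1 2) (D (4 * i).+2 2) (D (4 * i).+3 2).
rewrite /is_vertex !coord4 ?bound4 n0 hi /degree /=.
rewrite ?(not_edge _ 3 false) // ?(not_edge (4 * i) 3) ?(not_edge (4 * i).+3 3)
  ?(not_edge (4 * i).+1 1 false) ?(not_edge (4 * i).+3 1 false)
  ?(not_edge (4 * i).+2 2 false) /= ?coord4 ?bound4 ?andbF //.
rewrite /a /c.
case: (m _ 1 false); case: (m (4 * i).+1 2 false); case: (m (4 * i).+3 2 false);
case: (m (4 * i).+1 3 true); case: (m (4 * i).+2 3 true);
 case: (m (4 * i) 2 true); case: (m (4 * i).+1 2 true); case: (m (4 * i).+2 2 true);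
 case: (m (4 * i).+3 2 true);
  by move=> /(_ isT) h1 /(_ isT) h2 /(_ isT) h3 /(_ isT) h4 /(_ isT) h5 /(_ isT) h6.
Qed.

Lemma lower_half i : i < n ->
  (m (4 * i) 1 true = c i && ~~ b i) * (m (4 * i).+1 1 true = ~~ c i && ~~ b i) *
  (m (4 * i).+2 1 true = ~~ c i && b i) * (m (4 * i).+3 1 true = c i && b i) *
  (m (4 * i).+1 0 true = ~~ b i) * (m (4 * i).+2 0 true = b i) *
  (m (4 * i).+3 0 false = ~~ b i).
Proof.
move=> hi; have n0 : 0 < n by lia.
have D x y := m_degree x y.
move: (D (4 * i).+1 0) (D (4 * i).+2 0) (D (4 * i).+3 0)
      (D (4 * i).+1 1) (D (4 * i).+2 1) (D (4 * i).+3 1).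
rewrite /is_vertex !coord4 ?bound4 n0 hi /degree /=.
rewrite ?(not_edge (4 * i) 0) ?(not_edge (4 * i).+3 0 true)
  ?(not_edge (4 * i).+1 1 false) ?(not_edge (4 * i).+3 1 false)
  ?(not_edge (4 * i).+2 0 false) /= ?coord4 ?bound4 ?andbF //.
rewrite /b /c.
case: (m _ 1 false); case: (m (4 * i).+1 0 false); case: (m (4 * i).+3 0 false);
case: (m (4 * i).+1 0 true); case: (m (4 * i).+2 0 true);
 case: (m (4 * i) 1 true); case: (m (4 * i).+1 1 true); case: (m (4 * i).+2 1 true);
 case: (m (4 * i).+3 1 true);
  by move=> /(_ isT) h1 /(_ isT) h2 /(_ isT) h3 /(_ isT) h4 /(_ isT) h5 /(_ isT) h6.
Qed.

Lemma junction i y : 0 < n -> i <= n -> (y == 1) || (y == 2) ->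
  ((0 < i) && m (4 * i).-1 y true) + m (4 * i) y true + m (4 * i) 1 false = 1.
Proof.
move=> n0 hi hy; have : is_vertex n (4 * i) y.
  by rewrite /is_vertex n0 bound4 hi; case/orP: hy => /eqP ->.
move/m_degree; rewrite /degree; have -> : (0 < 4 * i) = (0 < i) by lia.
by case/orP: hy => /eqP -> /=;
  rewrite ?(not_edge _ 0 false) ?(not_edge _ 2 false) /= ?coord4 ?andbF //; lia.
Qed.

Lemma pred4 i : (4 * i.+1).-1 = (4 * i).+3.
Proof. by lia. Qed.

Lemma center_same i : i < n -> c i -> a i = b i.
Proof.
elim: i => [|i IHi] hi ci.
  have n0 : 0 < n by [].
  have := junction 0 1 n0 isT isT; have := junction 0 2 n0 isT isT.
  by rewrite upper_half ?lower_half // ci /=; lia.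
have n0 : 0 < n by lia.
have hi' : i < n by lia.
have := junction i.+1 1 n0 (ltnW hi) isT; have := junction i.+1 2 n0 (ltnW hi) isT.
rewrite pred4 /= !upper_half ?lower_half // ci.
by case: (c i) (IHi hi') => [/(_ isT) ->|_] /=; lia.
Qed.

Lemma letter_of_proj i : i < n -> (center (letter_of m i) = c i) *
  (upper (letter_of m i) = a i) * (lower (letter_of m i) = b i).
Proof.
move=> hi; have := center_same i hi; rewrite /letter_of /c /a /b.
by case: (m (4 * i).+2 1 false) => [/(_ isT) <-|_].
Qed.

Let w := mkseq (letter_of m) n.

Lemma nth_word i : i < n -> nth free_letter w i = letter_of m i.
Proof. by move=> hi; rewrite nth_mkseq. Qed.

Lemma word_compatible : sorted compatible w.
Proof.
apply/(sortedP free_letter) => i; rewrite size_mkseq => hi; have hi' := ltnW hi.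
rewrite !nth_word // /compatible /left_letter /right_letter !letter_of_proj //.
have n0 : 0 < n by lia.
have := junction i.+1 2 n0 hi' isT; rewrite pred4 /= !upper_half //.
by case: (_ && _); case: (_ && _).
Qed.

Lemma word_usesE x y d : m x y d = word_uses n w x y d.
Proof.
rewrite /word_uses; case he: (is_edge n x y d); last exact: not_edge.
have [i hx] := mod4_cases x.
have [hi|hi] := ltnP i n; last first.
  have [-> -> -> n0]: [/\ x = 4 * n, y = 1, d = false & 0 < n].
    case: hx he => ->; case: d; case: y => [|[|[|[|y]]]] //=; rewrite ?coord4 ?bound4; try lia.
    by move=> h; split=> //; lia.
  rewrite /word_edge /= !coord4 /= (@nth_default _ _ _ n) ?size_mkseq //.
  have hn : n.-1 < n by lia.
  have := junction n 2 n0 (leqnn n) isT; have -> : (4 * n).-1 = (4 * n.-1).+3 by lia.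
  rewrite n0 /= (not_edge (4 * n)) ?upper_half //=; last by lia.
  by rewrite nth_word // /left_letter !letter_of_proj //; case: (_ && _); case: (m _ _ _).
rewrite /word_edge.
case: hx he => ->; case: d; case: y => [|[|[|[|y]]]] //=;
  rewrite ?coord4 ?bound4 ?andbF //= => _;
  rewrite ?coord4 /= (nth_word i) // ?letter_of_proj // ?upper_half ?lower_half //=;
  try by [case: (a i) | case: (b i)].
have n0 : 0 < n by lia.
have := junction i 2 n0 (ltnW hi) isT; rewrite /right_letter !letter_of_proj //.
case: i hi => [|i] hi; first by rewrite upper_half //=; case: (_ && _); case: (m _ _ _).
have hi' := ltnW hi; rewrite pred4 /= nth_word // /left_letter !letter_of_proj // !upper_half //.
by case: (_ && _); case: (_ && _); case: (m _ _ _).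
Qed.
End Decode.

Lemma uses_inj n (M M' : {set {set pV n}}) :
  M \subset pyrene_ES n -> M' \subset pyrene_ES n ->
  (forall x y d, uses n M x y d = uses n M' x y d) -> M = M'.
Proof.
move=> /subsetP hM /subsetP hM' E; apply/setP => e; apply/idP/idP => he.
  have /pyrene_ESP[x [y [d [h De]]]] := hM _ he.
  by have := E x y d; rewrite /uses h -De he.
have /pyrene_ESP[x [y [d [h De]]]] := hM' _ he.
by have := E x y d; rewrite /uses h -De he.
Qed.

Definition matching_word n (M : {set {set pV n}}) : n.-tuple letter :=
  Tuple (introT eqP (size_mkseq (letter_of (uses n M)) n)).

Lemma matching_wordK n (M : {set {set pV n}}) :
  perfect_matching (pyrene_VS n) (pyrene_ES n) M ->
  word_matching n (matching_word n M) = M.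
Proof.
move=> /perfect_matchingP[ME hM]; apply: uses_inj => // [|x y d].
  exact: word_matching_sub.
rewrite uses_word_matching; symmetry; apply: word_usesE => // x' y' d'.
by case/andP.
Qed.

Lemma matching_word_compatible n (M : {set {set pV n}}) :
  perfect_matching (pyrene_VS n) (pyrene_ES n) M -> sorted compatible (matching_word n M).
Proof.
move=> /perfect_matchingP[ME hM]; apply: word_compatible => // x' y' d'.
by case/andP.
Qed.

Lemma word_matchingK n (w : n.-tuple letter) : matching_word n (word_matching n w) = w.
Proof.
apply/val_inj/(@eq_from_nth _ free_letter) => [|i]; rewrite /= size_mkseq ?size_tuple // => hi.
rewrite nth_mkseq // /letter_of !uses_word_matching /word_uses /word_edge /= !coord4 ?bound4 hi.
have -> : 0 < n by lia.
by case: (nth _ _ _) => [a|[a b]] /=; case: a => //; case: b.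
Qed.

Definition nfree (w : seq letter) : nat := count (fun l => ~~ center l) w.

Section WordForcing.
Variables (n : nat) (w : n.-tuple letter).
Hypothesis w_compatible : sorted compatible w.
Let l i := nth free_letter w i.

(* [(i, false)] is the hexagon above the middle edge of fragment [i] and [(i, true)] the
   one below if the middle edge is unused; otherwise only [(i, false)] is kept and stands
   for the alternating hexagon beside the middle edge. *)
Definition alternating : {set 'I_n * bool} :=
  [set j : 'I_n * bool | center (l j.1) ==> ~~ j.2].

Definition half_letter (b : bool) (k : letter) : bool := if b then lower k else upper k.

Definition key_coord (i : nat) (b : bool) : nat :=
  if center (l i) then (if upper (l i) then (4 * i).+3 else 4 * i)
  else (if half_letter b (l i) then (4 * i).+2 else (4 * i).+1).

Definition key_edge (j : 'I_n * bool) : {set pV n} :=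
  edge n (key_coord j.1 j.2) (if j.2 then 1 else 2) true.

Definition flip_letter (b : bool) (k : letter) : letter :=
  if center k then inr (upper k, upper k)
  else if b then inr (upper k, ~~ lower k) else inr (~~ upper k, lower k).

Definition flip_word (j : 'I_n * bool) : n.-tuple letter :=
  Tuple (introT eqP (size_mkseq (fun k => if k == j.1 then flip_letter j.2 (l k) else l k) n)).

Lemma nth_flip_word j k :
  nth free_letter (flip_word j) k = if k == j.1 then flip_letter j.2 (l k) else l k.
Proof.
have [hk|hk] := ltnP k n; first by rewrite /= nth_mkseq.
rewrite /= [LHS]nth_default ?size_mkseq //; case: eqP hk => [->|_ hk].
  by rewrite leqNgt ltn_ord.
by rewrite /l nth_default ?size_tuple.
Qed.

Lemma center_flip b k : center (flip_letter b k) = false.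
Proof. by case: k b => [a|[a b]] []. Qed.

Lemma flip_letter_neq b k : flip_letter b k != k.
Proof. by case: k b => [[]|[[] []]] []. Qed.

Lemma flip_word_compatible j : sorted compatible (flip_word j).
Proof.
apply/sorted_compatibleP => i; rewrite !nth_flip_word.
have /sorted_compatibleP/(_ i) := w_compatible.
rewrite /compatible /left_letter /right_letter -/(l _) -/(l _).
by case: eqP => _; case: eqP => _; rewrite ?center_flip ?andbF /=.
Qed.

Lemma flip_word_neq j : flip_word j != w.
Proof.
apply/eqP => /(congr1 (fun u : n.-tuple letter => nth free_letter u j.1)).
by rewrite nth_flip_word eqxx => /eqP; rewrite (negPf (flip_letter_neq _ _)).
Qed.

Lemma flip_word_edge j x y d : j \in alternating -> is_edge n x y d -> word_edge w x y d ->
  ~~ word_edge (flip_word j) x y d ->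
  x %/ 4 = j.1 /\ j.2 = ~~ center (l (x %/ 4)) && (y < 2).
Proof.
move: (flip_word j) (nth_flip_word j) => f nth_f.
case: j nth_f => i b nth_f; rewrite inE /= => hb he.
have [k hx] := mod4_cases x.
have hk : x %/ 4 = k by case: hx => ->; rewrite coord4.
rewrite hk; case: (boolP [&& x %% 4 == 0, y == 1 & ~~ d]) => [|special].
  case/and3P=> /eqP hr /eqP -> /negPf ->; rewrite /word_edge hr /= hk !nth_f /= -/(l _).
  have L (u : nat) : left_letter (if u == i then flip_letter b (l u) else l u) ->
      left_letter (l u).
    by case: eqP => // _; rewrite /left_letter center_flip.
  have R (u : nat) : right_letter (if u == i then flip_letter b (l u) else l u) ->
      right_letter (l u).
    by case: eqP => // _; rewrite /right_letter center_flip.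
  rewrite negbK => /negP h /orP[/andP[k0 /L hl]|/R hr']; case: h; apply/orP; [left|right] => //.
  by rewrite k0.
have [ek|nk] := eqVneq k i; last first.
  move=> hw /negP[]; move: hw; rewrite /word_edge hk nth_f (negPf nk) -/(l _).
  case: y d special he => [|[|[|[|y]]]] [] //=; rewrite !andbT => special he.
  case: ifP => // r2; move: special he.
  by case: hx r2 => ->; rewrite !coord4 ?andbF.
rewrite /word_edge !nth_f -/(l _) hk ek eqxx; move: hb; rewrite -ek.
case: hx he special => ->; case: d; case: y => [|[|[|[|y]]]] //=;
  rewrite ?coord4 ?bound4 ?andbF //= => _ _;
  by case: (l k) b {nth_f} => [[]|[[] []]] [].
Qed.

Lemma key_coord_lt i b : i < n -> key_coord i b < 4 * n.
Proof. by move=> hi; rewrite /key_coord; do 3?case: ifP => _; lia. Qed.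

Lemma mem_key_edge (u : seq letter) (j : 'I_n * bool) : (key_edge j \in word_matching n u) =
  word_edge u (key_coord j.1 j.2) (if j.2 then 1 else 2) true.
Proof.
have := uses_word_matching n u (key_coord j.1 j.2) (if j.2 then 1 else 2) true.
rewrite /uses /word_uses -/(key_edge j).
suff -> : is_edge n (key_coord j.1 j.2) (if j.2 then 1 else 2) true by [].
by case: j.2; exact: key_coord_lt.
Qed.

Lemma key_coord_used j : j \in alternating ->
  word_edge w (key_coord j.1 j.2) (if j.2 then 1 else 2) true.
Proof.
case: j => i b; rewrite inE /= /key_coord.
rewrite /word_edge; case E: (l i) => [[]|[[] []]]; case: b => //= _;
  by rewrite !coord4 -/(l _) E.
Qed.

Lemma key_coord_forces (u : seq letter) i :
  (forall b, center (l i) ==> ~~ b ->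
     word_edge u (key_coord i b) (if b then 1 else 2) true) ->
  nth free_letter u i = l i.
Proof.
move=> hu; move: (hu false) (hu true); rewrite /key_coord /word_edge.
case: (l i) => [[]|[[] []]] /=; rewrite !coord4 => /(_ isT) h1;
  first [move=> /(_ isT) | move=> _]; move: h1;
  by case: (nth _ _ _) => [[]|[[] []]].
Qed.

Lemma forcing_number_word :
  forcing_number (pyrene_VS n) (pyrene_ES n) (word_matching n w) = n + nfree w.
Proof.
have -> : n + nfree w = #|alternating|.
  rewrite -sum1_card (eq_bigl (fun j : 'I_n * bool => center (l j.1) ==> ~~ j.2)); last first.
    by move=> j; rewrite inE.
  rewrite -(pair_big_dep xpredT (fun i b => center (l (i : 'I_n)) ==> ~~ b) (fun _ _ => 1)) /=.
  rewrite /nfree -sum1_count big_mkcond big_tuple -{1}(card_ord n) -sum1_card -big_split /=.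
  apply: eq_bigr => i _; rewrite /l (tnth_nth free_letter) big_mkcond /= big_bool.
  by case: (center _).
have PM := word_matching_perfect _ _ w_compatible.
apply: (@forcing_number_card _ _ _ _ _ _ key_edge (fun j => word_matching n (flip_word j))).
- apply/andP; split.
    by apply/subsetP => _ /imsetP[j hj ->]; rewrite mem_key_edge key_coord_used.
  apply/forallP => M'; apply/implyP => /andP[PM' /subsetP sub].
  rewrite -(matching_wordK n M' PM'); apply/eqP; congr (word_matching n _).
  apply/(@eq_from_nth _ free_letter) => [|i]; rewrite !size_tuple // => hi.
  apply: key_coord_forces => b hb.
  rewrite -(mem_key_edge _ (Ordinal hi, b)) matching_wordK // sub //.
  by apply: imset_f; rewrite inE.
- by move=> j _; apply/word_matching_perfect/flip_word_compatible.
- move=> j _; apply: contra_neq (flip_word_neq j) => E.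
  by rewrite -[LHS]word_matchingK E word_matchingK.
- move=> e j k hj hk /imsetP[[[x y] d]]; rewrite inE /= => /andP[he hw] -> hej hek.
  have F i : edge n x y d \notin word_matching n (flip_word i) ->
      ~~ word_edge (flip_word i) x y d.
    by apply: contra => hi; have := uses_word_matching n (flip_word i) x y d;
       rewrite /uses /word_uses he hi.
  have [j1 j2] := flip_word_edge j _ _ _ hj he hw (F _ hej).
  have [k1 k2] := flip_word_edge k _ _ _ hk he hw (F _ hek).
  rewrite (surjective_pairing j) (surjective_pairing k) j2 k2.
  by congr (_, _); apply: val_inj; rewrite /= -j1.
Qed.

End WordForcing.

Local Open Scope ring_scope.

Lemma big_cons_tuple (R : nmodType) (T : finType) n (P : pred (seq T)) (F : seq T -> R) :
  \sum_(w : n.+1.-tuple T | P w) F w =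
  \sum_(l : T) \sum_(w : n.-tuple T | P (l :: w)) F (l :: w).
Proof.
rewrite pair_big_dep /= (reindex (fun p : T * n.-tuple T => [tuple of p.1 :: p.2])) //=.
exists (fun w => (thead w, [tuple of behead w])) => [[l w] _|w _] /=.
  by congr (_, _); apply: val_inj.
by rewrite [RHS]tuple_eta; apply: val_inj.
Qed.

Definition word_poly (n : nat) : {poly int} :=
  \sum_(w : n.-tuple letter | sorted compatible w) 'X^(n + nfree w).

Lemma pyrene_forcing_poly_word n : pyrene_forcing_poly n = word_poly n.
Proof.
rewrite /pyrene_forcing_poly /forcing_poly /word_poly.
rewrite (reindex_onto (fun w : n.-tuple letter => word_matching n w)
  (matching_word n)) /=; last first.
  by move=> M; apply: matching_wordK.
apply: eq_big => [w|w /andP[PM /eqP <-]]; last first.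
  by rewrite forcing_number_word //; apply: matching_word_compatible.
apply/andP/idP => [[PM /eqP <-]|hw]; first exact: matching_word_compatible.
by rewrite word_matchingK eqxx word_matching_perfect.
Qed.

Lemma path_compatible l (w : seq letter) :
  ~~ left_letter l -> path compatible l w = sorted compatible w.
Proof. by case: w => //= k w hl; rewrite /compatible (negPf hl). Qed.

Definition left_poly (n : nat) : {poly int} :=
  \sum_(w : n.-tuple letter | path compatible (inl true) w) 'X^(n + nfree w).

Lemma big_letter (F : letter -> {poly int}) :
  \sum_l F l = F (inl true) + F (inl false) +
  (F (inr (true, true)) + F (inr (true, false)) +
   (F (inr (false, true)) + F (inr (false, false)))).
Proof.
rewrite big_sumType /= big_bool; congr (_ + _).
rewrite (eq_bigr (fun p => F (inr (p.1, p.2)))) => [|[a b] _ //].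
by rewrite -(pair_bigA _ (fun a b => F (inr (a, b)))) /= !big_bool.
Qed.

Lemma word_poly0 : word_poly 0 = 1.
Proof.
by rewrite /word_poly (big_pred1 [tuple]) //= => w; rewrite tuple0; symmetry; apply: eqxx.
Qed.

Lemma left_poly0 : left_poly 0 = 1.
Proof.
by rewrite /left_poly (big_pred1 [tuple]) //= => w; rewrite tuple0; symmetry; apply: eqxx.
Qed.

Lemma sum_cons_letter n l (P : pred (seq letter)) :
  \sum_(w : n.-tuple letter | P w) 'X^(n.+1 + nfree (l :: w)) =
  'X^(1 + ~~ center l) * \sum_(w : n.-tuple letter | P w) 'X^(n + nfree w) :> {poly int}.
Proof.
by rewrite mulr_sumr; apply: eq_bigr => w _; rewrite -exprD /nfree /=; congr (_ ^+ _); lia.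
Qed.

Lemma sum_path_compatible n l : ~~ left_letter l ->
  \sum_(w : n.-tuple letter | path compatible l w) 'X^(n + nfree w) = word_poly n.
Proof. by move=> hl; apply: eq_bigl => w; rewrite path_compatible. Qed.

Lemma word_polyS n :
  word_poly n.+1 = (4%:R * 'X^2 + 'X) * word_poly n + 'X * left_poly n.
Proof.
rewrite {1}/word_poly (@big_cons_tuple _ _ _ (sorted compatible)
  (fun w => 'X^(n.+1 + nfree w))).
rewrite big_letter !sum_cons_letter -/(left_poly n) /= !sum_path_compatible //.
by ring.
Qed.

Lemma left_polyS n : left_poly n.+1 = word_poly n.+1 - 'X * word_poly n.
Proof.
rewrite {1}/left_poly (@big_cons_tuple _ _ _ (path compatible (inl true))
  (fun w => 'X^(n.+1 + nfree w))).
have E l : \sum_(w : n.-tuple letter | path compatible (inl true) (l :: w))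
      'X^(n.+1 + nfree (l :: w)) = if right_letter l then 0
    else 'X^(1 + ~~ center l) *
      \sum_(w : n.-tuple letter | path compatible l w) 'X^(n + nfree w) :> {poly int}.
  rewrite -sum_cons_letter; case: ifP => hl; [rewrite big_pred0 | apply: eq_bigl] => // w;
    by rewrite /= [compatible _ _]/compatible hl.
rewrite big_letter !E /= -/(left_poly n) !sum_path_compatible // word_polyS.
by ring.
Qed.

Lemma word_polySS n :
  word_poly n.+2 = (4%:R * 'X^2 + 2%:R * 'X) * word_poly n.+1 - 'X^2 * word_poly n.
Proof. by rewrite word_polyS left_polyS; ring. Qed.

(* Up to rescaling, the Chebyshev polynomials of the second kind. *)
Definition cheb_term {R : comNzRingType} (t : R) (n k : nat) : R :=
  (-1) ^+ k * t ^+ (n - 2 * k) *+ 'C(n - k, k).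

Definition cheb {R : comNzRingType} (t : R) (n : nat) : R := \sum_(k < n.+1) cheb_term t n k.

Lemma cheb_term_small {R : comNzRingType} (t : R) n k : (n < 2 * k)%N -> cheb_term t n k = 0.
Proof. by move=> h; rewrite /cheb_term bin_small ?mulr0n //; lia. Qed.

Lemma cheb_termSS {R : comNzRingType} (t : R) n k :
  cheb_term t n.+2 k.+1 = t * cheb_term t n.+1 k.+1 - cheb_term t n k.
Proof.
have [h|h] := ltnP n (2 * k); first by rewrite !cheb_term_small ?mulr0 ?subr0 //; lia.
rewrite /cheb_term; have -> : (n.+2 - k.+1 = (n - k).+1)%N by lia.
have -> : (n.+2 - 2 * k.+1 = n - 2 * k)%N by lia.
have -> : (n.+1 - k.+1 = n - k)%N by lia.
rewrite binS mulrnDr; congr (_ + _); last by rewrite exprS mulN1r mulNr mulNrn.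
have [h'|h'] := ltnP (n - k)%N k.+1; first by rewrite bin_small // !mulr0n mulr0.
have -> : (n - 2 * k = (n.+1 - 2 * k.+1).+1)%N by lia.
by rewrite [t ^+ _.+1]exprS mulrCA mulrnAr.
Qed.

Lemma chebSS {R : comNzRingType} (t : R) n : cheb t n.+2 = t * cheb t n.+1 - cheb t n.
Proof.
have E : cheb t n.+1 = cheb_term t n.+1 0 + \sum_(k < n.+2) cheb_term t n.+1 k.+1.
  rewrite big_ord_recr /= (cheb_term_small t n.+1 n.+2) ?addr0; last by lia.
  by rewrite /cheb big_ord_recl; congr (_ + _).
have E' : cheb t n = \sum_(k < n.+2) cheb_term t n k.
  by rewrite big_ord_recr /= (cheb_term_small t n n.+1) ?addr0 //; lia.
rewrite {1}/cheb big_ord_recl E E' mulrDr -addrA; congr (_ + _).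
  by rewrite /cheb_term !subn0 !bin0 /= !mulr1n !expr0 !mul1r exprS.
by rewrite mulr_sumr -sumrB; apply: eq_bigr => k _; rewrite -cheb_termSS.
Qed.

Lemma word_poly_cheb n : word_poly n = 'X^n * cheb (2%:R + 4%:R * 'X) n.
Proof.
suff [] : word_poly n = 'X^n * cheb (2%:R + 4%:R * 'X) n /\
  word_poly n.+1 = 'X^(n.+1) * cheb (2%:R + 4%:R * 'X) n.+1 by [].
elim: n => [|n [IH1 IH2]]; last first.
  by split=> //; rewrite word_polySS IH1 IH2 chebSS !exprS; ring.
rewrite word_polyS left_poly0 word_poly0 /cheb !big_ord_recl !big_ord0 /cheb_term /=.
by split; rewrite ?subn0 ?bin0 /= ?bin_small // ?expr0 ?expr1 ?mulr0n ?mulr1n; ring.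
Qed.

Lemma cheb_expand n : cheb (2%:R + 4%:R * 'X) n =
  \sum_(j < n.+1) \sum_(i < n.+1 | (j + n <= 2 * i)%N)
     ((-1) ^+ (n - i) * (2 ^ (2 * i + j - n) * 'C(i, n - i) * 'C(2 * i - n, j))%:Z)%:P
       * 'X^j :> {poly int}.
Proof.
rewrite (exchange_big_dep xpredT) //= /cheb (reindex_inj rev_ord_inj) /=.
apply: eq_bigr => i _; have hi := ltn_ord i; rewrite subSS /cheb_term.
have -> : (n - (n - i) = i)%N by lia.
have [h|h] := ltnP (2 * i) n.
  rewrite bin_small ?mulr0n; last by lia.
  by rewrite big_pred0 // => j; lia.
have -> : (n - 2 * (n - i) = 2 * i - n)%N by lia.
rewrite exprDn (big_ord_widen n.+1
  (fun j => 2%:R ^+ (2 * i - n - j) * (4%:R * 'X) ^+ j *+ 'C(2 * i - n, j))); last by lia.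
rewrite mulr_sumr -sumrMnl; apply: eq_big => [j|j hj]; first by lia.
have -> : (2 * i + j - n = (2 * i - n - j) + 2 * j)%N by lia.
have E4 : 4%:R = 2%:R ^+ 2 :> {poly int} by rewrite expr2 -natrM.
have polyC_nat k : (k%:Z)%:P = k%:R :> {poly int} by rewrite -natz rmorph_nat.
rewrite exprMn E4 -exprM polyCM polyC_nat rmorphXn /= polyCN.
set a := (2 * i - n - j)%N; set b := (2 * j)%N.
rewrite natrM natrM (natrX _ 2%N (a + b)) exprD.
rewrite -[in LHS](mulr_natr _ 'C(i, n - i)) -[in LHS](mulr_natr _ 'C(2 * i - n, j)).
move: (2%:R ^+ a) (2%:R ^+ b) ('C(i, n - i)%:R) ('C(2 * i - n, j)%:R) => u v c d.
by ring.
Qed.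

Theorem theorem3p2 (n : nat) :
  pyrene_forcing_poly n =
  'X^n * \sum_(j < n.+1) \sum_(i < n.+1 | (j + n <= 2 * i)%N)
     ((-1) ^+ (n - i) * (2 ^ (2 * i + j - n) * 'C(i, n - i) * 'C(2 * i - n, j))%:Z)%:P
       * 'X^j.
Proof. by rewrite pyrene_forcing_poly_word word_poly_cheb cheb_expand. Qed.
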